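(* Let $m\ge 3$. Define the $m\times m$ simple biquadratic form $$P_{m,m,2m}(\mathbf{x},\mathbf{y}) = \sum_{i=1}^m x_i^2 y_i^2 + \sum_{i=1}^m x_i^2 y_{i+1}^2,$$ where the index $y_{m+1}$ is interpreted as $y_1$ (cyclic addition modulo $m$). Then $\operatorname{sos}(P_{m,m,2m}) = 2m$.
   Context: An $m\times n$ biquadratic form is a real polynomial $P(\mathbf{x},\mathbf{y})=\sum_{i,k=1}^{m}\sum_{j,l=1}^{n} a_{ijkl}x_ix_ky_jy_l$ in variables $\mathbf{x}=(x_1,\dots,x_m)$, $\mathbf{y}=(y_1,\dots,y_n)$. It is called simple if it is a sum of distinct terms of the type $x_i^2y_j^2$ (each with coefficient $1$), i.e. $P=\sum_{(i,j)\in E}x_i^2y_j^2$ for some nonempty set $E\subseteq\{1,\dots,m\}\times\{1,\dots,n\}$. A bilinear form is a polynomial $\sum_{i,j} c_{ij}x_iy_j$ with real coefficients. $P$ is SOS if it is a finite sum of squares of bilinear forms; its SOS rank $\operatorname{sos}(P)$ is the smallest number of squares of bilinear forms in such a representation. *)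

(* Defs.v *)
From mathcomp Require Import all_boot all_order all_algebra.
From mathcomp Require Import boolp reals.
From mathcomp Require Import mpoly.

Set Implicit Arguments.
Unset Strict Implicit.
Unset Printing Implicit Defensive.

Import GRing.Theory.
Local Open Scope ring_scope.

(* Polynomials in x_1, ..., x_m, y_1, ..., y_n live in {mpoly R[m + n]}: the
   first m variables are the x's, the last n are the y's. *)
Definition xvar (R : realType) (m n : nat) (i : 'I_m) : {mpoly R[m + n]} :=
  'X_(lshift n i).
Definition yvar (R : realType) (m n : nat) (j : 'I_n) : {mpoly R[m + n]} :=
  'X_(rshift m j).
Arguments xvar R {m} n i.
Arguments yvar R m {n} j.

Definition bilinear_form (R : realType) (m n : nat) (b : {mpoly R[m + n]})
    : Prop :=
  exists c : 'M[R]_(m, n),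
    b = \sum_(i < m) \sum_(j < n) c i j *: (xvar R n i * yvar R m j).

Definition simple_biquadratic (R : realType) (m n : nat)
    (p : {mpoly R[m + n]}) : Prop :=
  exists2 E : {set 'I_m * 'I_n},
    E != set0 & p = \sum_(e in E) xvar R n e.1 ^+ 2 * yvar R m e.2 ^+ 2.

Definition sos_of (R : realType) (m n : nat) (p : {mpoly R[m + n]}) (r : nat)
    : Prop :=
  exists b : 'I_r -> {mpoly R[m + n]},
    (forall k, bilinear_form (b k)) /\ p = \sum_(k < r) b k ^+ 2.

Definition is_sos (R : realType) (m n : nat) (p : {mpoly R[m + n]}) : Prop :=
  exists r, sos_of p r.

Lemma is_sos_asbool (R : realType) (m n : nat) (p : {mpoly R[m + n]}) :
  is_sos p -> exists r, `[< sos_of p r >].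
Proof. by case=> r pr; exists r; apply/asboolP. Qed.

(* The value is 0 by convention when p is not SOS; an SOS form has rank 0 only
   if it is zero. *)
Definition sos_rank (R : realType) (m n : nat) (p : {mpoly R[m + n]}) : nat :=
  match pselect (is_sos p) with
  | left sos_p => ex_minn (is_sos_asbool sos_p)
  | right _ => 0%N
  end.

(* [ordS] is the cyclic successor on 'I_m. *)
Definition Pcyc (R : realType) (m : nat) : {mpoly R[m + m]} :=
  \sum_(i < m) xvar R m i ^+ 2 * yvar R m i ^+ 2
  + \sum_(i < m) xvar R m i ^+ 2 * yvar R m (ordS i) ^+ 2.

Lemma Pcyc_simple (R : realType) (m : nat) :
  (2 <= m)%N -> simple_biquadratic (Pcyc R m).
Proof.
move=> m2; pose D := [set (i, i) | i : 'I_m].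
pose D' := [set (i, ordS i) | i : 'I_m].
have dDD' : [disjoint D & D'].
  rewrite -setI_eq0; apply/eqP/setP=> e; rewrite !inE; apply/negP.
  case/andP=> /imsetP[i _ ->] /imsetP[j _ [<- /(congr1 val) /= ij]].
  have := ltn_ord i; rewrite leq_eqVlt => /orP[/eqP im | im].
    by move: ij m2; rewrite im modnn => i0; rewrite -im i0.
  by move: ij; rewrite modn_small // => /eqP; rewrite ltn_eqF.
exists (D :|: D').
  apply/set0Pn; exists (Ordinal (ltnW m2), Ordinal (ltnW m2)).
  by rewrite inE; apply/orP; left; apply/imsetP; exists (Ordinal (ltnW m2)).
under eq_bigl do rewrite inE; rewrite bigU //= /D /D'.
by congr (_ + _); rewrite big_imset //= => i j _ _ [].
Qed.

(* Main.v *)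
Require Import Defs.
From mathcomp Require Import all_boot all_order all_algebra.
From mathcomp Require Import reals.
From mathcomp Require Import boolp mpoly ring.

(** Write an SOS representation with [r] squares as the squared norm of
    [\sum_(i, j) x_i y_j v_ij], where [v_ij] in [R^r] lists the coefficients of
    [x_i y_j] in the [r] bilinear forms.  Comparing coefficients with
    [\sum_((i, j) in E) x_i^2 y_j^2] ([sos_gram]) says that [v_ij] has norm 1 or
    0 according to whether [(i, j)] is in [E], and that
    [v_ij . v_kl + v_il . v_kj = 0] whenever [(i, j)] differs from [(k, l)].

    View [E] as the edge set of a bipartite graph.  If it has no 4-cycle, then
    for two distinct edges [(i, j)] and [(k, l)] either the two summands above
    coincide (the edges share an endpoint) or one of [v_il], [v_kj] vanishes;
    in both cases [v_ij . v_kl = 0].  The vectors of the edges are thus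
    orthonormal in [R^r], which forces [#|E| <= r], and the representation by
    monomials is optimal ([sos_rank_C4_free]).

    The form [Pcyc] belongs to the cycle of length [2m] through the [m] rows and
    the [m] columns, which has no 4-cycle as soon as [3 <= m]. *)

Set Implicit Arguments.
Unset Strict Implicit.
Unset Printing Implicit Defensive.

Import GRing.Theory Num.Theory.
Local Open Scope ring_scope.

(** * Evaluation of bilinear and edge forms *)

Definition edge_form (R : realType) (m n : nat) (E : {set 'I_m * 'I_n}) :
    {mpoly R[m + n]} :=
  \sum_(e in E) xvar R n e.1 ^+ 2 * yvar R m e.2 ^+ 2.

Definition C4_free (m n : nat) (E : {set 'I_m * 'I_n}) : Prop :=
  forall i k j l, i != k -> j != l ->
  (i, j) \in E -> (i, l) \in E -> (k, j) \in E -> (k, l) \in E -> False.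

Definition bilin (R : realType) (m n : nat) (c : 'M[R]_(m, n))
    (x : 'I_m -> R) (y : 'I_n -> R) : R :=
  \sum_i \sum_j c i j * (x i * y j).

Definition point (R : realType) (m n : nat) (x : 'I_m -> R) (y : 'I_n -> R)
    (k : 'I_(m + n)) : R :=
  match split k with inl i => x i | inr j => y j end.

Definition unitv (R : realType) (n : nat) (i j : 'I_n) : R := (j == i)%:R.

Section Evaluation.
Variables (R : realType) (m n : nat).
Implicit Types (x : 'I_m -> R) (y : 'I_n -> R) (c : 'M[R]_(m, n)).
Implicit Type E : {set 'I_m * 'I_n}.

Lemma meval_xvar x y i : (xvar R n i).@[point x y] = x i.
Proof. by rewrite mevalXU /point -[lshift n i]/(unsplit (inl i)) unsplitK. Qed.

Lemma meval_yvar x y j : (yvar R m j).@[point x y] = y j.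
Proof. by rewrite mevalXU /point -[rshift m j]/(unsplit (inr j)) unsplitK. Qed.

Lemma meval_bilinear c x y :
  (\sum_i \sum_j c i j *: (xvar R n i * yvar R m j)).@[point x y] = bilin c x y.
Proof.
rewrite raddf_sum; apply: eq_bigr => i _; rewrite raddf_sum.
by apply: eq_bigr => j _; rewrite /= mevalZ mevalM meval_xvar meval_yvar.
Qed.

Lemma meval_edge_form E x y :
  (edge_form R E).@[point x y] = \sum_(e in E) x e.1 ^+ 2 * y e.2 ^+ 2.
Proof.
rewrite raddf_sum; apply: eq_bigr => e _ /=.
by rewrite mevalM !rmorphXn /= meval_xvar meval_yvar.
Qed.

Lemma bilinDl c x x' y :
  bilin c (fun i => x i + x' i) y = bilin c x y + bilin c x' y.
Proof.
rewrite -big_split; apply: eq_bigr => i _; rewrite -big_split.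
by apply: eq_bigr => j _ /=; ring.
Qed.

Lemma bilinDr c x y y' :
  bilin c x (fun j => y j + y' j) = bilin c x y + bilin c x y'.
Proof.
rewrite -big_split; apply: eq_bigr => i _; rewrite -big_split.
by apply: eq_bigr => j _ /=; ring.
Qed.

Lemma bilin_unitv c i j : bilin c (unitv R i) (unitv R j) = c i j.
Proof.
rewrite /bilin (bigD1 i) //= (bigD1 j) //= /unitv !eqxx !mulr1.
rewrite !big1 ?addr0 // => [k /negPf ki | l /negPf lj]; last by rewrite lj !mulr0.
by rewrite big1 // => l _; rewrite ki mul0r mulr0.
Qed.

End Evaluation.

(** * The lower bound for graphs without 4-cycles *)

(** Polarization in both arguments: [polar Q] is multilinear when [Q] is quadratic
    in each argument, so its values at unit vectors isolate single coefficients
    of [Q]. *)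
Definition polar (R : realType) (m n : nat)
    (Q : ('I_m -> R) -> ('I_n -> R) -> R) x x' y y' : R :=
  let Qx z := Q (fun i => x i + x' i) z - Q x z - Q x' z in
  Qx (fun j => y j + y' j) - Qx y - Qx y'.

Section LowerBound.
Variables (R : realType) (m n : nat).
Implicit Types (x : 'I_m -> R) (y : 'I_n -> R) (c : 'M[R]_(m, n)).
Implicit Type E : {set 'I_m * 'I_n}.

Lemma polar_sum (I : finType) (P : pred I)
    (Q : I -> ('I_m -> R) -> ('I_n -> R) -> R) x x' y y' :
  polar (fun x y => \sum_(t | P t) Q t x y) x x' y y' =
  \sum_(t | P t) polar (Q t) x x' y y'.
Proof. by rewrite /polar -!sumrB. Qed.

Lemma polar_bilin_sqr c x x' y y' :
  polar (fun x y => bilin c x y ^+ 2) x x' y y' =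
  (bilin c x y * bilin c x' y' + bilin c x y' * bilin c x' y) *+ 2.
Proof. by rewrite /polar !bilinDl !bilinDr; ring. Qed.

Lemma polar_monomial i j x x' y y' :
  polar (fun x y => x i ^+ 2 * y j ^+ 2) x x' y y' =
  (x i * x' i * (y j * y' j)) *+ 4 :> R.
Proof. by rewrite /polar; ring. Qed.

(** Comparison of the coefficients of [x_i x_k y_j y_l] on both sides, obtained
    by polarizing the values of the two polynomials at unit vectors. *)
Lemma sos_gram E r : sos_of (edge_form R E) r ->
  exists c : 'I_r -> 'M[R]_(m, n), forall i k j l,
    \sum_t c t i j * c t k l + \sum_t c t i l * c t k j =
    ((i, j) == (k, l))%:R * ((i, j) \in E)%:R *+ 2.
Proof.
case=> b [/choice[c bE] sumE]; exists c => i k j l.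
have evalE x y :
    \sum_(e in E) x e.1 ^+ 2 * y e.2 ^+ 2 = \sum_t bilin (c t) x y ^+ 2.
  rewrite -meval_edge_form sumE raddf_sum; apply: eq_bigr => t _ /=.
  by rewrite rmorphXn /= bE meval_bilinear.
have := congr1 (fun Q => polar Q (unitv R i) (unitv R k) (unitv R j) (unitv R l))
  (funext (fun x => funext (evalE x))).
rewrite !polar_sum.
under eq_bigr do rewrite polar_monomial.
under [X in _ = X -> _]eq_bigr do rewrite polar_bilin_sqr !bilin_unitv.
rewrite !sumrMnl big_split /= [_ *+ 4](mulrnA _ 2 2) => /(pmulrnI (ltn0Sn 1)) <-.
congr (_ *+ 2); rewrite big_mkcond (bigD1 (i, j)) //= big1 ?addr0 => [|e eij].
  rewrite /unitv !eqxx !mul1r xpair_eqE -natrM mulnb.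
  by case: ifP; rewrite ?mulr0 ?mulr1.
case: ifP => // _; move: eij; case: e => u v; rewrite xpair_eqE /unitv /=.
by case: (u == i); case: (v == j); rewrite ?mul0r ?mulr0.
Qed.

(** The coefficient vectors of the edges are orthonormal in [R^r]; as the rows of
    a matrix [V] they satisfy [V *m V^T = 1], which bounds their number by [r]. *)
Lemma C4_free_sos_ge E r : C4_free E -> sos_of (edge_form R E) r -> (#|E| <= r)%N.
Proof.
move=> freeE /sos_gram[c cE].
(* For [(i, j)] off [E], [sos_gram] gives the vector [v_ij] squared norm 0. *)
have c0 t i j : (i, j) \notin E -> c t i j = 0.
  move=> /negPf ijE; have /eqP := cE i i j j.
  rewrite ijE mulr0 mul0rn -mulr2n mulrn_eq0 /=.
  rewrite psumr_eq0 => [/allP/(_ t)|s _]; last by rewrite -expr2 sqr_ge0.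
  by rewrite mem_index_enum mulf_eq0 orbb => /(_ isT)/eqP.
have orthE i j k l : (i, j) \in E -> (k, l) \in E ->
    \sum_t c t i j * c t k l = ((i, j) == (k, l))%:R.
  move=> ijE klE; have := cE i k j l; rewrite ijE mulr1.
  (* Edges with a common endpoint: [sos_gram] doubles their inner product. *)
  have [?|ik] := eqVneq i k; first subst k.
    under [X in _ + X]eq_bigr do rewrite mulrC.
    by rewrite -mulr2n => /eqP; rewrite eqr_pMn2r // => /eqP.
  have [?|jl] := eqVneq j l; first subst l.
    by rewrite -mulr2n => /eqP; rewrite eqr_pMn2r // => /eqP.
  (* Disjoint edges: one of [(i, l)], [(k, j)] is off [E], lest a 4-cycle arise. *)
  rewrite xpair_eqE (negPf ik) mul0rn [X in _ + X]big1 ?addr0 // => t _.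
  have [ilE|/c0-> //] := boolP ((i, l) \in E); last by rewrite mul0r.
  have [kjE|/c0-> //] := boolP ((k, j) \in E); last by rewrite mulr0.
  by case: (freeE i k j l).
pose V := \matrix_(e < #|E|, t < r) c t (enum_val e).1 (enum_val e).2.
apply: (@mulmx1_min R _ _ V V^T); apply/matrixP => e f; rewrite !mxE.
under eq_bigr do rewrite !mxE.
by rewrite orthE -?surjective_pairing ?enum_valP // (inj_eq enum_val_inj).
Qed.

End LowerBound.

(** * The SOS rank for graphs without 4-cycles *)

Lemma edge_form_sos (R : realType) (m n : nat) (E : {set 'I_m * 'I_n}) :
  sos_of (edge_form R E) #|E|.
Proof.
exists (fun k => xvar R n (enum_val k).1 * yvar R m (enum_val k).2); split=> [k|].
  exists (delta_mx (enum_val k).1 (enum_val k).2).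
  rewrite (bigD1 (enum_val k).1) //= (bigD1 (enum_val k).2) //= !mxE !eqxx scale1r.
  rewrite !big1 ?addr0 // => [i /negPf ik | j /negPf jk]; last first.
    by rewrite mxE jk andbF scale0r.
  by rewrite big1 // => j _; rewrite mxE ik scale0r.
by rewrite /edge_form big_enum_val; apply: eq_bigr => k _; rewrite exprMn.
Qed.

Lemma sos_rank_C4_free (R : realType) (m n : nat) (E : {set 'I_m * 'I_n}) :
  C4_free E -> sos_rank (edge_form R E) = #|E|.
Proof.
move=> freeE; have sosE := edge_form_sos R E.
rewrite /sos_rank; case: pselect => [sos_p|]; last by case; exists #|E|.
case: ex_minnP => r /asboolP sos_r min_r; apply/eqP.
by rewrite eqn_leq (C4_free_sos_ge freeE sos_r) andbT min_r //; apply/asboolP.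
Qed.

(** * The cycle of length 2m *)

Definition cycle_edges (m : nat) : {set 'I_m * 'I_m} :=
  [set e | (e.2 == e.1) || (e.2 == ordS e.1)].

Section Cycle.
Variable m : nat.

Lemma ordS_neq (i : 'I_m) : (1 < m)%N -> ordS i != i.
Proof.
case: i => i im m1; rewrite -val_eqE /=.
have [im'|] := ltnP i.+1 m; first by rewrite modn_small // gtn_eqF.
move=> mi; have -> : i.+1 = m by apply/eqP; rewrite eqn_leq im mi.
by rewrite modnn; apply: contraTneq m1 => i0; rewrite -ltnNge; move: mi; rewrite -i0.
Qed.

(** Otherwise [m] would divide 2. *)
Lemma ordSS_neq (i : 'I_m) : (2 < m)%N -> ordS (ordS i) != i.
Proof.
move=> m2; rewrite -val_eqE /= -addn1 modnDml addn1.
apply: contraTneq m2 => i2; rewrite -leqNgt.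
have : (i + 2 == i + 0 %[mod m])%N by rewrite addn0 addn2 i2 modn_small.
by rewrite eqn_modDl mod0n => /dvdn_leq; apply.
Qed.

Lemma big_cycle_edges (V : nmodType) (F : 'I_m * 'I_m -> V) : (1 < m)%N ->
  \sum_(e in cycle_edges m) F e = \sum_i F (i, i) + \sum_i F (i, ordS i).
Proof.
move=> m1; rewrite -big_split /=.
transitivity (\sum_i \sum_(j | (j == i) || (j == ordS i)) F (i, j)).
  by rewrite pair_big_dep; apply: eq_big => [[i j]|[]]; rewrite ?inE.
apply: eq_bigr => i _; have Si := ordS_neq i m1.
rewrite (bigD1 i) ?eqxx //= (bigD1 (ordS i)) ?eqxx ?orbT //= big1 ?addr0 // => j.
by case: (j == i) => //=; rewrite ?andbF //; case: (j == ordS i).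
Qed.

Lemma card_cycle_edges : (1 < m)%N -> #|cycle_edges m| = (2 * m)%N.
Proof.
move=> m1; rewrite -sum1_card (big_cycle_edges (fun _ => 1%N)) //.
by rewrite !sum1_card !card_ord mul2n -addnn.
Qed.

(** Rows [i != k] with two common neighbours have the same neighbour set, so
    [k = ordS i] and [i = ordS k]; but [ordS] has no orbit of length 2 here. *)
Lemma cycle_edges_C4_free : (2 < m)%N -> C4_free (cycle_edges m).
Proof.
move=> m2 i k j l; rewrite !inE /=.
have /eqP SSi := ordSS_neq i m2; move=> /eqP ik /eqP jl.
by do 4![case/orP=> /eqP ?]; congruence.
Qed.

End Cycle.

Theorem theorem2p7 (R : realType) (m : nat) (hm : (3 <= m)%N) :
  sos_rank (Pcyc R m) = (2 * m)%N.
Proof.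
have m1 : (1 < m)%N by apply: ltnW.
rewrite -card_cycle_edges // -(sos_rank_C4_free R (cycle_edges_C4_free hm)).
by rewrite /edge_form big_cycle_edges.
Qed.
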